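(* Let $(X,\tau)$ be a Suslinean chainable continuum and let $\leq_{\mathcal{U}}^{\mathcal{D}}$ be an ultrafilter order on $X$. Then the set $M=\{(x,y)\in X^2:x\leq_{\mathcal{U}}^{\mathcal{D}}y\}$ is of both type $F_\sigma$ and $G_\delta$ in $(X,\tau)^2$.
   Context: A continuum is a compact connected metrizable space; fix a metric generating its topology. A chain in $X$ is a finite sequence of open sets $d_1,\dots,d_k$ (its links) with $d_i\cap d_j\neq\varnothing\iff|i-j|\le 1$; its mesh is the maximum of the diameters of its links. $X$ is chainable if for every $\varepsilon>0$ it is covered by a chain of mesh less than $\varepsilon$. $\mathbb{N}=\{1,2,3,\dots\}$. Let $\mathcal{D}=\{D_n\}_{n\in\mathbb{N}}$ be a sequence of chains $D_n=\{d_{1,n},\dots,d_{k_n,n}\}$, each covering $X$, with $\mathrm{mesh}(D_n)\to 0$, and let $\mathcal{U}$ be a non-principal ultrafilter on $\mathbb{N}$. Write $x\leq_{D_n}y$ iff there exist $i\le j\le k_n$ with $x\in d_{i,n}$ and $y\in d_{j,n}$, and $x\leq_{\mathcal{U}}^{\mathcal{D}}y$ iff $\{n\in\mathbb{N}: x\leq_{D_n}y\}\in\mathcal{U}$. This is a linear order on $X$. An ultrafilter order on $X$ is any order of the form $\leq_{\mathcal{U}}^{\mathcal{D}}$ for some such $\mathcal{D}$ and $\mathcal{U}$. A continuum is Suslinean if any collection of its pairwise disjoint nondegenerate (more than one point) subcontinua is countable. *)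

(* Defs.v *)
From mathcomp Require Import all_boot all_order all_algebra.
From mathcomp Require Import all_classical all_reals all_analysis.

Set Implicit Arguments.
Unset Strict Implicit.
Unset Printing Implicit Defensive.

Import Order.TTheory GRing.Theory Num.Theory.

Local Open Scope classical_set_scope.
Local Open Scope ring_scope.

Definition continuum (T : topologicalType) (K : set T) : Prop :=
  compact K /\ connected K.

Definition nondegenerate_set (T : Type) (K : set T) : Prop :=
  exists x y, [/\ K x, K y & x <> y].

Definition suslinean (T : topologicalType) : Prop :=
  forall C : set (set T),
    (forall K, C K -> continuum K /\ nondegenerate_set K) ->
    trivIset C id -> countable C.

Section chains.
Context {R : realType} {X : metricType R}.

(* Extended-real valued, so that an unbounded set has diameter +oo. *)
Definition diameter (A : set X) : \bar R :=
  ereal_sup [set (mdist x y)%:E | x in A & y in A].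

(* The links of a chain are indexed from 0. *)
Definition is_chain (D : seq (set X)) : Prop :=
  (forall i, (i < size D)%N -> open (nth set0 D i)) /\
  (forall i j, (i < size D)%N -> (j < size D)%N ->
     (nth set0 D i `&` nth set0 D j !=set0 <-> `|i%:Z - j%:Z| <= 1)).

Definition mesh (D : seq (set X)) : \bar R :=
  \big[maxe/0%E]_(d <- D) diameter d.

Definition chain_covers (D : seq (set X)) : Prop :=
  \bigcup_(i < size D) nth set0 D i = [set: X].

Definition chain_le (D : seq (set X)) (x y : X) : Prop :=
  exists i j, [/\ (i <= j)%N, (j < size D)%N, nth set0 D i x & nth set0 D j y].

Definition vanishing_chain_covers (D : nat -> seq (set X)) : Prop :=
  (forall n, is_chain (D n) /\ chain_covers (D n)) /\
  mesh (D n) @[n --> \oo] --> 0%E.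

Definition ultrafilter_le (D : nat -> seq (set X)) (U : set_system nat)
  (x y : X) : Prop := U [set n | chain_le (D n) x y].

End chains.

Definition chainable {R : realType} (X : metricType R) : Prop :=
  forall e : R, 0 < e ->
    exists D : seq (set X), [/\ is_chain D, chain_covers D & (mesh D < e%:E)%E].

Definition nonprincipal_ultrafilter (T : Type) (U : set_system T) : Prop :=
  UltraFilter U /\ forall t : T, U <> principal_filter t.

(* Main.v *)
From HB Require Import structures.
Require Import Defs.
From mathcomp Require Import all_boot all_order all_algebra.
From mathcomp Require Import all_classical all_reals all_analysis.
From mathcomp Require Import borel_hierarchy.
From mathcomp Require Import zify.

Local Open Scope classical_set_scope.

Set Implicit Arguments.
Unset Strict Implicit.
Unset Printing Implicit Defensive.

Import Order.TTheory GRing.Theory Num.Theory.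

Local Open Scope ring_scope.

(**
The idea is that a Suslinean continuum is covered, at every scale, by countably
many subcontinua, and that an ultrafilter order cannot tell apart the points of
a subcontinuum when they are compared with a point outside of it.

Order and continua.  Let [A] and [B] be disjoint continua.  As soon as the mesh
of [D n] is small, no link of [D n] meets both ([near_no_common_link]).  A link
that misses a connected set leaves the whole set on one side of it, so [A] lies
entirely before [B] in the chain, or entirely after it
([chain_le_connected]).  A non-principal ultrafilter ignores the finitely many
remaining [n], hence [A `*` B] is contained in the order or disjoint from it
([ultrafilter_le_disjoint_continua]).

Countably many continua.  The components of a closed set [A] are pairwise
disjoint continua, so in a Suslinean space only countably many of them have
more than one point.  If [A] is not the whole space, boundary bumping
([boundary_bumping]) puts every interior point of [A] in one of those.  Letting
[A] run through the closures of a countable base gives a countable family of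
continua such that any two distinct points belong to disjoint members of it
([suslinean_separating_continua]).

Conclusion.  The products of two members of this family, together with the
diagonal, form a countable family of closed sets of the square, and both the
order and its complement are unions of members of it.  Thus the order and its
complement are both countable unions of closed sets.
*)

(** * Quasi-components and boundary bumping *)

Section boundary_bumping.
Context {T : topologicalType}.
Implicit Types (A F W : set T) (x : T).

(** Otherwise the sets [F `\` W] form a filter base of closed sets, and a
    cluster point of it would be in the intersection but outside [W]. *)
Lemma compact_bigcap_sub_open (FF : set (set T)) W :
  compact [set: T] -> FF !=set0 -> (forall F, FF F -> closed F) ->
  setI_closed FF -> open W -> \bigcap_(F in FF) F `<=` W ->
  exists2 F, FF F & F `<=` W.
Proof.
move=> cT [F0 FF0] clF FFI oW capW; apply: contrapT => noF.
pose G := filter_from FF (fun F => F `\` W).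
have GF : ProperFilter G.
  apply: filter_from_proper.
    apply: filter_from_filter; first by exists F0.
    move=> F1 F2 FF1 FF2; exists (F1 `&` F2); first exact: FFI.
    by move=> z [[? ?] ?].
  move=> F FFF; apply: contrapT => /nonemptyPn; rewrite setD_eq0 => FW.
  by apply: noF; exists F.
have [z [_]] := cT G GF filterT.
rewrite clusterE => Gz.
have inF F : FF F -> (F `\` W) z.
  move=> FFF; have clFW : closed (F `\` W).
    by apply: closedI; [exact: clF|exact: open_closedC].
  by rewrite (iffLR (closure_id _) clFW); apply: Gz; exists F.
have [_] := inF _ FF0; apply; apply: capW => F FFF.
by have [] := inF _ FFF.
Qed.

(** Closedness is required in the whole space: for closed [A] these are exactly
    the clopen subsets of the subspace [A]. *)
Definition relatively_clopen A F :=
  [/\ F `<=` A, closed F & exists2 O, open O & F = A `&` O].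

Definition quasi_component A x :=
  \bigcap_(F in [set F | relatively_clopen A F /\ F x]) F.

Lemma relatively_clopenI A x :
  setI_closed [set F | relatively_clopen A F /\ F x].
Proof.
move=> F G [[FA cF [V oV FV]] Fx] [[GA cG [V2 oV2 GV2]] Gx]; split=> //; split.
- by move=> z [Fz _]; exact: FA.
- exact: closedI.
- by exists (V `&` V2); [exact: openI|rewrite FV GV2 setIACA setIid].
Qed.

Lemma relatively_clopen_refl A : closed A -> relatively_clopen A A.
Proof. by move=> cA; split=> //; exists setT; [exact: openT|rewrite setIT]. Qed.

Lemma quasi_component_refl A x : quasi_component A x x.
Proof. by move=> F [_ Fx]. Qed.

Lemma quasi_component_closed A x : closed (quasi_component A x).
Proof. by apply: closed_bigI => F [[]]. Qed.

Lemma quasi_component_sub A x :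
  closed A -> A x -> quasi_component A x `<=` A.
Proof. by move=> cA Ax z; apply; split=> //; exact: relatively_clopen_refl. Qed.

(** In a compact space a quasi-component can be approximated from outside by a
    single relatively clopen set. *)
Lemma quasi_component_sub_open A x W :
  compact [set: T] -> closed A -> A x -> open W -> quasi_component A x `<=` W ->
  exists F, [/\ relatively_clopen A F, F x & F `<=` W].
Proof.
move=> cT cA Ax oW QW.
have [||F [rF Fx] FW] :=
  compact_bigcap_sub_open cT _ _ (@relatively_clopenI A x) oW QW.
- by exists A; split=> //; exact: relatively_clopen_refl.
- by move=> F [[]].
- by exists F.
Qed.

(** If the quasi-component split into closed pieces [E false] and [E true], by
    normality some open [U] around the former would have a closure missing the
    latter.  A relatively clopen [F] approximating the quasi-component avoids
    the boundary of [U], so [F `&` U] is still relatively clopen, contains [x]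
    and misses [E true]: a contradiction. *)
Lemma quasi_component_connected A x :
  hausdorff_space T -> compact [set: T] -> closed A -> A x ->
  connected (quasi_component A x).
Proof.
move=> hT cT cA Ax; apply/connectedP => E [E0 QE sE].
wlog E0x : E E0 QE sE / E false x.
  move=> wl; have := @quasi_component_refl A x; rewrite QE => -[|E1x].
    exact: (wl E).
  apply: (wl (E \o negb)) => //=; first by rewrite setUC.
  by rewrite separatedC.
have [sE0 sE1] := sE.
have clE b : closed (E b).
  apply/closure_id/seteqP; split; first exact: subset_closure.
  move=> z clz; have : quasi_component A x z.
    rewrite (iffLR (closure_id _) (@quasi_component_closed A x)).
    by apply: closureS clz; rewrite QE; case: b => ? ?; [right|left].
  rewrite QE; case: b clz => clz [] // Ez; exfalso.
    by have : (E false `&` closure (E true)) z by []; rewrite sE1.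
  by have : (closure (E false) `&` E true) z by []; rewrite sE0.
have [] := @compact_normal _ hT cT (E false) (clE false) (~` E true).
  apply/set_nbhsP; exists (~` E true); split=> //.
  - exact/closed_openC/clE.
  - by apply/disjoints_subset/separated_disjoint.
move=> P /set_nbhsP[U [oU E0U UP]] clPE1.
pose W := U `|` ~` closure P.
have oW : open W by apply: openU => //; exact/closed_openC/closed_closure.
have QW : quasi_component A x `<=` W.
  rewrite QE => z [/E0U|E1z]; first by left.
  by right=> /clPE1.
have [F [[FA cF [V oV FV]] Fx FW]] := quasi_component_sub_open cT cA Ax oW QW.
have FU : F `&` U = F `&` closure P.
  apply/seteqP; split=> z [Fz].
    by move=> Uz; split=> //; apply: subset_closure; exact: UP.
  by move=> Pz; split=> //; have [] := FW _ Fz.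
have rFU : relatively_clopen A (F `&` U).
  split.
  - by move=> z [Fz _]; exact: FA.
  - by rewrite FU; apply: closedI => //; exact: closed_closure.
  - by exists (V `&` U); [exact: openI|rewrite FV setIA].
have [z E1z] := E0 true.
have Qz : quasi_component A x z by rewrite QE; right.
have [|_ Uz] := Qz (F `&` U); first by split=> //; split=> //; exact: E0U.
by apply: (clPE1 z) => //; apply: subset_closure; exact: UP.
Qed.

(** If the quasi-component of [x] were contained in the interior of [A], so
    would be a relatively clopen set containing [x]; such a set is clopen in the
    connected space [T], hence all of [T], although [A] is a proper subset. *)
Lemma boundary_bumping A x :
  hausdorff_space T -> compact [set: T] -> connected [set: T] ->
  closed A -> A <> setT -> A° x ->
  exists2 z, connected_component A x z & ~ A° z.
Proof.
move=> hT cT coT cA AT iAx.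
have Ax : A x by exact: interior_subset.
have [z Qz niAz] : exists2 z, quasi_component A x z & ~ A° z.
  apply: contrapT => noz.
  have QA : quasi_component A x `<=` A°.
    by move=> z Qz; apply: contrapT => niAz; apply: noz; exists z.
  have oA : open A° by exact: open_interior.
  have [F [[FA cF [V oV FV]] Fx FiA]] :=
    quasi_component_sub_open cT cA Ax oA QA.
  apply: AT; apply/seteqP; split=> // z _; apply: FA.
  suff -> : F = setT by [].
  apply: coT; first by exists x.
    exists (A° `&` V); first exact: openI.
    rewrite setTI; apply/seteqP; split=> t.
      by move=> Ft; split; [exact: FiA|move: Ft; rewrite FV => -[]].
    by move=> [/interior_subset At Vt]; rewrite FV.
  by exists F => //; rewrite setTI.
exists z => //; apply: connected_component_max Qz.
- exact: quasi_component_refl.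
- exact: quasi_component_sub.
- exact: quasi_component_connected.
Qed.

End boundary_bumping.

(** * Separating points by countably many continua *)

Lemma suslinean_countable_components (T : topologicalType) (A : set T) :
  suslinean T -> compact [set: T] -> closed A ->
  countable [set K | range (connected_component A) K /\ nondegenerate_set K].
Proof.
move=> sT cT cA; apply: sT => [_ [[x _ <-] ndK]|_ _ [[x _ <-] _] [[y _ <-] _]].
  split=> //; split; last exact: component_connected.
  exact: subclosed_compact (component_closed cA) cT _.
move=> [z [xz yz]]; rewrite (same_connected_component xz).
by rewrite (same_connected_component yz).
Qed.

(** Transfers [compact_second_countable] to nonempty spaces that do not come
    with a distinguished point. *)
Lemma compact_metric_second_countable (R : realType) (X : metricType R) :
  compact [set: X] -> [set: X] !=set0 -> @second_countable X.
Proof.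
move=> cX [x0 _].
pose ptX := isPointed.Build X x0.
pose pX : pseudoPMetricType R := HB.pack (X : Type) X ptX.
exact: (@compact_second_countable R pX).
Qed.

(** The family consists of the nondegenerate components of the closures of the
    members of a countable base: by regularity every neighborhood of a point
    contains the closure of a basic open set containing that point, and boundary
    bumping makes the component of the point in this closure nondegenerate. *)
Lemma suslinean_separating_continua (R : realType) (X : metricType R) :
  continuum [set: X] -> suslinean X ->
  exists KK : set (set X), [/\ countable KK, KK `<=` @continuum X &
    forall x y, x <> y ->
      exists K L, [/\ KK K, KK L, K x, L y & K `&` L = set0]].
Proof.
move=> [cX coX] sX.
have [X0|/nonemptyPn X0] := pselect ([set: X] !=set0); last first.
  exists set0; split=> // x.
  by have : [set: X] x by []; rewrite X0.
have hX : hausdorff_space X by exact: metric_hausdorff.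
have [B cB [oB baseB]] := compact_metric_second_countable cX X0.
pose comps (V : set X) :=
  [set K | range (connected_component (closure V)) K /\ nondegenerate_set K].
pose KK := \bigcup_(V in B) comps V.
have small x W : open W -> W x -> W <> setT ->
    exists K, [/\ KK K, K x & K `<=` W].
  move=> oW Wx WT.
  have [P Px PW] : filter_from (nbhs x) closure W.
    by apply: uniform_regular; exact: open_nbhs_nbhs.
  have [V [BV Vx] VP] := baseB x P Px.
  have VW : closure V `<=` W by apply: subset_trans PW; exact: closureS.
  have iVx : (closure V)° x.
    apply: (filterS (@subset_closure _ V)).
    by apply: open_nbhs_nbhs; split=> //; exact: oB.
  have VT : closure V <> setT.
    by move=> VT; apply: WT; apply/seteqP; split=> // z _; apply: VW; rewrite VT.
  have [z Kz niVz] := boundary_bumping hX cX coX (@closed_closure _ V) VT iVx.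
  have Kx : connected_component (closure V) x x.
    by apply: connected_component_refl; apply: subset_closure.
  exists (connected_component (closure V) x); split=> //.
    exists V => //; split; first by exists x.
    by exists x, z; split=> // xz; apply: niVz; rewrite -xz.
  by apply: subset_trans VW; exact: connected_component_sub.
exists KK; split.
- apply: bigcup_countable => // V BV.
  by apply: suslinean_countable_components => //; exact: closed_closure.
- move=> _ [V BV [[x _ <-] _]]; split; last exact: component_connected.
  exact: subclosed_compact (component_closed (@closed_closure _ V)) cX _.
move=> x y /eqP xy; have := hX; rewrite open_hausdorff.
move=> /(_ x y xy) [[U V] /= [/set_mem Ux /set_mem Vy] [oU oV UV]].
have UV0 z : U z -> V z -> False.
  by move=> Uz Vz; have : (U `&` V) z by []; rewrite (eqP UV).
have [|K [KKK Kx KU]] := small x U oU Ux.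
  by move=> UT; apply: (UV0 y) => //; rewrite UT.
have [|L [KKL Ly LV]] := small y V oV Vy.
  by move=> VT; apply: (UV0 x) => //; rewrite VT.
exists K, L; split=> //; apply/seteqP; split=> // z [/KU Uz /LV].
exact: UV0.
Qed.

(** * Chains and connected sets *)

Lemma connected_sub_open (T : topologicalType) (A U V : set T) :
  connected A -> open U -> open V -> A `<=` U `|` V -> U `&` V = set0 ->
  A `&` U !=set0 -> A `<=` U.
Proof.
move=> cA oU oV AUV UV0 AU0.
suff <- : A `&` U = A by move=> z [].
apply: cA => //; first by exists U.
exists (~` V); first exact: open_closedC.
apply/seteqP; split=> z [Az].
  by move=> Uz; split=> // Vz; have : (U `&` V) z by []; rewrite UV0.
by move=> nVz; split=> //; case: (AUV z Az).
Qed.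

Lemma nth_set0_size (T : Type) (D : seq (set T)) i x :
  nth set0 D i x -> (i < size D)%N.
Proof. by apply: contraPT; rewrite -leqNgt => /(nth_default set0) ->. Qed.

Section chain_order.
Context {R : realType} {X : metricType R}.
Variable D : seq (set X).
Hypotheses (chainD : is_chain D) (coverD : chain_covers D).
Implicit Types A B : set X.

Let below j := \bigcup_(i in [set i | (i < j)%N]) nth set0 D i.
Let above j := \bigcup_(i in [set i | (j < i)%N]) nth set0 D i.

Let link_open i : open (nth set0 D i).
Proof.
have [[oD _] [iD|iD]] := (chainD, ltnP i (size D)); first exact: oD.
by rewrite nth_default //; exact: open0.
Qed.

Let below_above j : below j `&` above j = set0.
Proof.
apply/seteqP; split=> // z [[i /= ij di] [k /= jk dk]].
have [_ /(_ i k (nth_set0_size di) (nth_set0_size dk)) [+ _]] := chainD.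
have ik : (i.+1 < k)%N by exact: leq_ltn_trans jk.
have dik : nth set0 D i `&` nth set0 D k !=set0 by exists z.
move=> /(_ dik); lia.
Qed.

Let below_above_cover A j :
  A `&` nth set0 D j = set0 -> A `<=` below j `|` above j.
Proof.
move=> Aj z Az; have [i /= iD di] : (\bigcup_(i < size D) nth set0 D i) z.
  by rewrite coverD.
have [ij|ji|ij] := ltngtP i j; first by left; exists i.
  by right; exists i.
have : (A `&` nth set0 D j) z by rewrite -ij.
by rewrite Aj.
Qed.

(** If [a] is in an earlier link than [b], the link [j] of [b] misses [A], so all
    of [A] stays before [j]; then the link [i'] of [a'] is before [j] and misses
    [B], so all of [B] stays after [i']. *)
Lemma chain_le_connected A B a b a' b' :
  connected A -> connected B ->
  (forall i x y, A x -> B y -> nth set0 D i x -> nth set0 D i y -> False) ->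
  A a -> B b -> A a' -> B b' -> chain_le D a b -> chain_le D a' b'.
Proof.
move=> cA cB noAB Aa Bb Aa' Bb' [i [j [ij jD di dj]]].
have oU (P : set nat) : open (\bigcup_(i in P) nth set0 D i).
  by apply: bigcup_open => k _; exact: link_open.
have {}ij : (i < j)%N.
  rewrite ltn_neqAle ij andbT; apply/eqP => eij.
  by rewrite eij in di; exact: noAB di dj.
have [i' /= i'j di'] : below j a'.
  apply: (connected_sub_open cA (oU _) (oU _) _ (below_above j)) => //.
    apply: below_above_cover; apply/seteqP; split=> // z [Az dz].
    exact: noAB dz dj.
  by exists a; split=> //; exists i.
have [j' /= i'j' dj'] : above i' b'.
  apply: (connected_sub_open cB (oU _) (oU _)) => //.
  - rewrite setUC; apply: below_above_cover; apply/seteqP; split=> // z [Bz dz].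
    exact: noAB di' dz.
  - by rewrite setIC; exact: below_above.
  - by exists b; split=> //; exists j.
by exists i', j'; split=> //; [exact: ltnW|exact: nth_set0_size dj'].
Qed.

End chain_order.

Lemma mdist_lt_mesh (R : realType) (X : metricType R) (D : seq (set X))
    (e : R) i x y :
  (mesh D < e%:E)%E -> nth set0 D i x -> nth set0 D i y -> mdist x y < e.
Proof.
move=> De dx dy; rewrite -lte_fin; apply: le_lt_trans De.
have iD : (i < size D)%N by exact: nth_set0_size dx.
apply: (@le_trans _ _ (diameter (nth set0 D i))).
  by apply: ereal_sup_ubound; exists x => //; exists y.
by rewrite /mesh; apply: (le_bigmax_seq 0%E (nth set0 D i)) => //; exact: mem_nth.
Qed.

(** Every point of [A] has a ball missing [B]; points of half that ball are too
    far from [B] for a link of small diameter.  Compactness of [A] makes the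
    index uniform. *)
Lemma near_no_common_link (R : realType) (X : metricType R)
    (D : nat -> seq (set X)) (A B : set X) :
  mesh (D n) @[n --> \oo] --> 0%E -> compact A -> closed B -> A `&` B = set0 ->
  \forall n \near \oo,
    forall i x y, A x -> B y ->
      nth set0 (D n) i x -> nth set0 (D n) i y -> False.
Proof.
move=> D0 /compact_near_coveringP cA clB AB0.
pose P n x := forall i y, B y ->
  nth set0 (D n) i x -> nth set0 (D n) i y -> False.
suff : \forall n \near \oo, A `<=` P n.
  by apply: filterS => n AP i x y Ax By; exact: AP.
apply: cA => x Ax.
have : nbhs x (~` B).
  apply: open_nbhs_nbhs; split; first exact: closed_openC.
  by move=> Bx; have : (A `&` B) x by []; rewrite AB0.
move=> /nbhs_ballP [r /= r0 rB].
have r20 : 0 < r / 2 by rewrite divr_gt0.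
have nD : \forall n \near \oo, (mesh (D n) < (r / 2)%:E)%E.
  exact: (D0 _ (@nbhs_open_ereal_lt R 0 (fun=> r / 2) r20)).
near=> x' n => /= i y By dx' dy; apply: (rB y) => //.
rewrite [r]splitr; apply: (@ball_triangle _ _ x').
  by near: x'; exact: nbhsx_ballx.
rewrite ballEmdist /=; apply: mdist_lt_mesh dx' dy.
by near: n.
Unshelve. all: by end_near. Qed.

(** * Ultrafilter orders on pairs of disjoint continua *)

Lemma nonprincipal_ultrafilter_eventually (U : set_system nat) :
  nonprincipal_ultrafilter U -> \oo `<=` U.
Proof.
move=> [uU npU] A [N _ NA].
have Ut t : U (~` [set t]).
  have [Ut|//] := in_ultra_setVsetC [set t] uU.
  exfalso; apply: (npU t); apply/esym/max_filter => [|B UB].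
    exact: principal_filter_proper.
  apply/principal_filterP.
  have UtB : U ([set t] `&` B) by exact: filterI.
  by have [s [<-]] := filter_ex UtB.
apply: filterS NA _; elim: N => [|N IH].
  by apply: filterS filterT.
have UN : U ([set n | (N <= n)%N] `&` ~` [set N]) by exact: filterI.
apply: filterS UN => n /= [Nn /eqP nN].
by rewrite ltn_neqAle eq_sym nN.
Qed.

(** The two pairs of points play symmetric roles, so this says that the order is
    constant on [A `*` B]. *)
Lemma ultrafilter_le_disjoint_continua (R : realType) (X : metricType R)
    (D : nat -> seq (set X)) (U : set_system nat) (A B : set X) a b a' b' :
  vanishing_chain_covers D -> nonprincipal_ultrafilter U ->
  continuum A -> continuum B -> A `&` B = set0 ->
  A a -> B b -> A a' -> B b' ->
  ultrafilter_le D U a b -> ultrafilter_le D U a' b'.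
Proof.
move=> [chD D0] npU [cA coA] [cB coB] AB0 Aa Bb Aa' Bb'.
have [uU _] := npU.
have clB : closed B by apply: compact_closed => //; exact: metric_hausdorff.
have noAB : U [set n | forall i x y, A x -> B y ->
      nth set0 (D n) i x -> nth set0 (D n) i y -> False].
  apply: nonprincipal_ultrafilter_eventually => //.
  exact: near_no_common_link.
rewrite /ultrafilter_le => Uab.
apply: filterS (filterI noAB Uab) => n /= [noABn].
have [chn covn] := chD n.
exact: (chain_le_connected chn covn coA coB noABn).
Qed.

(** * Countable unions of closed sets *)

Lemma Fsigma_countable_network (T : topologicalType) (S : set T)
    (CC : set (set T)) :
  countable CC -> CC `<=` closed ->
  (forall p, S p -> exists C, [/\ CC C, C p & C `<=` S]) -> Fsigma S.
Proof.
move=> cCC clCC net; pose CS := [set C | CC C /\ C `<=` S].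
have SE : S = \bigcup_(C in CS) C.
  apply/seteqP; split=> [p /net[C [CCC Cp CS_]]|p [C [_]]]; last exact.
  by exists C.
have cCS : countable CS by apply: sub_countable cCC; apply: subset_card_le => C [].
have [CS0|[f]] := pfcard_geP cCS.
  by rewrite SE CS0 bigcup_set0; apply: closed_Fsigma; exact: closed0.
exists f => [n|].
  by have [/clCC] : CS (f n) by exact: funS.
rewrite SE; apply/seteqP; split=> [p [C CSC Cp]|p [n _ fnp]].
  by have [n _ fn] := 'surj_f CSC; exists n => //; rewrite fn.
by exists (f n) => //; exact: funS.
Qed.

Lemma Fsigma_setC_Gdelta (T : topologicalType) (S : set T) :
  Fsigma (~` S) -> Gdelta S.
Proof.
move=> [F clF SF]; exists (fun n => ~` F n).
  by move=> n; exact/closed_openC/clF.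
by rewrite -setC_bigcup -SF setCK.
Qed.

Lemma closed_diagonal (T : topologicalType) :
  hausdorff_space T -> closed (@diagonal T).
Proof.
move=> hT [x y] clxy; apply: hT => A B Ax By.
have [|[z w] [/= zw [Az Bw]]] := clxy (A `*` B); first by exists (A, B).
by exists z; split=> //; rewrite /diagonal/= in zw; rewrite zw.
Qed.

Lemma closed_setM (T T' : topologicalType) (A : set T) (B : set T') :
  closed A -> closed B -> closed (A `*` B).
Proof.
move=> cA cB; have -> : A `*` B = fst @^-1` A `&` snd @^-1` B by [].
by apply: closedI; apply: closed_comp => // p _; [exact: cvg_fst|exact: cvg_snd].
Qed.

Lemma ultrafilter_le_refl (R : realType) (X : metricType R)
    (D : nat -> seq (set X)) (U : set_system nat) x :
  vanishing_chain_covers D -> Filter U -> ultrafilter_le D U x x.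
Proof.
move=> [chD _] FU; rewrite /ultrafilter_le.
apply: filterS filterT => n _.
have [_ covn] := chD n.
have [i /= iD di] : (\bigcup_(i < size (D n)) nth set0 (D n) i) x.
  by rewrite covn.
by exists i, i.
Qed.

Theorem theorem7p4 (R : realType) (X : metricType R)
    (D : nat -> seq (set X)) (U : set_system nat)
    (X_continuum : continuum [set: X])
    (X_suslinean : suslinean X)
    (X_chainable : chainable X)
    (D_chains : vanishing_chain_covers D)
    (U_ultra : nonprincipal_ultrafilter U) :
  Fsigma [set p : X * X | ultrafilter_le D U p.1 p.2] /\
  Gdelta [set p : X * X | ultrafilter_le D U p.1 p.2].
Proof.
have hX : hausdorff_space X by exact: metric_hausdorff.
have [uU _] := U_ultra.
have [KK [cKK KKc sep]] := suslinean_separating_continua X_continuum X_suslinean.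
pose box (KL : set X * set X) := KL.1 `*` KL.2.
pose CC := [set diagonal] `|` box @` (KK `*` KK).
have cCC : countable CC.
  rewrite /CC -bigcup2E; apply: bigcup_countable => // -[|[|n]] _ /=.
  - exact: countable1.
  - by apply: sub_countable (card_image_le _ _) _; exact: countableX.
  - exact: countable0.
have clCC : CC `<=` closed.
  move=> _ [->|[[K L] [/= /KKc [cK _] /KKc [cL _]] <-]].
    exact: closed_diagonal.
  by apply: closed_setM; exact: compact_closed.
split.
  apply: Fsigma_countable_network cCC clCC _ => -[x y] /= xy.
  have [exy|/sep [K [L [KKK KKL Kx Ly KL0]]]] := pselect (x = y).
    exists diagonal; split=> //; first by left.
    move=> [z w] /= zw; rewrite /diagonal /= in zw.
    by rewrite zw; exact: ultrafilter_le_refl.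
  exists (K `*` L); split=> //; first by right; exists (K, L).
  move=> [z w] [/= Kz Lw].
  exact: (ultrafilter_le_disjoint_continua D_chains U_ultra
            (KKc _ KKK) (KKc _ KKL) KL0 Kx Ly Kz Lw).
apply: Fsigma_setC_Gdelta.
apply: Fsigma_countable_network cCC clCC _ => -[x y] /= nxy.
have /sep [K [L [KKK KKL Kx Ly KL0]]] : x <> y.
  by move=> exy; apply: nxy; rewrite exy; exact: ultrafilter_le_refl.
exists (K `*` L); split=> //; first by right; exists (K, L).
move=> [z w] [/= Kz Lw] zw; apply: nxy.
exact: (ultrafilter_le_disjoint_continua D_chains U_ultra
          (KKc _ KKK) (KKc _ KKL) KL0 Kz Lw Kx Ly).
Qed.
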